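(* Assume $c=1$, i.e. $a^{ij}b_ib_j=-1$. The space with metric function $F$ is metrically isomorphic to the factor-pseudo-Riemannian space with metric tensor $t_{mn}(x,\zeta)=p(x,\zeta)a_{mn}(x)$, where $$p(x,\zeta)=\frac1{h^2}\,|S^2(x,\zeta)|^{(1-h)/h},\qquad S^2(x,\zeta)=a_{ij}(x)\zeta^i\zeta^j .$$ Precisely: at each $x\in M$, on the time-like sector and on the space-like sector of $T_xM$, the map $y\mapsto\zeta=\zeta(x,y)$ given by $$\zeta^m=\Bigl[h\,v^m-\bigl(b+\tfrac12 g q\bigr)b^m\Bigr]\frac{J}{\varkappa h},\qquad v^m=y^m+b\,b^m,\qquad \varkappa=\frac1h|F^2|^{(1-h)/2},$$ is a diffeomorphism onto its image and satisfies, at fixed $x$, $$g_{mn}(x,y)\,dy^m\,dy^n=t_{mn}(x,\zeta)\,d\zeta^m\,d\zeta^n .$$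
   Context: Let $M$ be an $N$-dimensional smooth manifold with a pseudo-Riemannian metric tensor $a_{ij}(x)$ of signature $(+,-,\dots,-)$ and inverse $a^{ij}$, a 1-form $b_i(x)$ with $a^{ij}b_ib_j=-1$, and a scalar field $g(x)$. Put $b^i=a^{ij}b_j$. For $y\in T_xM$ put $$b=b_i(x)y^i,\quad r_{ij}=a_{ij}+b_ib_j,\quad \gamma=r_{ij}y^iy^j,\quad q=\sqrt{|\gamma|},\quad B=\gamma-g\,b\,q-b^2 .$$ Time-like sector ($\epsilon=1$, any real $g$): the $y$ with $\gamma>0$ and $B>0$. There $h=\sqrt{1+g^2/4}$, $G=g/h$, $g_\pm=-\frac12g\pm h$, $B=(b-g_-q)(g_+q-b)$ and $J=\left(\frac{b-g_-q}{g_+q-b}\right)^{-G/4}$. Space-like sector ($\epsilon=-1$, $-2<g<2$): the $y$ with $\gamma<0$ (so $B=-(q^2+gbq+b^2)<0$). There $h=\sqrt{1-g^2/4}$, $G=g/h$, $L=q+\frac g2 b$, $J=e^{-\frac12 G f}$ with $f=-\arctan\frac G2+\arctan\frac{L}{hb}$ if $b<0$, $f=-\pi-\arctan\frac G2+\arctan\frac{L}{hb}$ if $b>0$ and, by continuity, $f=-\frac\pi2-\arctan\frac G2$ if $b=0$. In both sectors $F^2=BJ^2$ and $g_{ij}=\frac12\frac{\partial^2F^2}{\partial y^i\partial y^j}$. *)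

(* Defs.v *)
From HB Require Import structures.
From mathcomp Require Import all_boot all_order all_algebra.
From mathcomp Require Import all_classical all_reals all_analysis.
Import Order.TTheory GRing.Theory Num.Theory.
Import numFieldNormedType.Exports.

Set Implicit Arguments.
Unset Strict Implicit.
Unset Printing Implicit Defensive.

Local Open Scope classical_set_scope.
Local Open Scope ring_scope.

Section Smoothness.
Context {R : realType} {V W : normedModType R}.

(* [f] is of class C^n on the open set [U]: [f] is (Frechet) differentiable on
   [U] and all its directional derivatives are of class C^(n-1). For [V] of
   finite dimension this is the usual notion. *)
Fixpoint Ck_on (n : nat) (U : set V) (f : V -> W) : Prop :=
  if n is m.+1 then
    (forall x, U x -> differentiable f x) /\
    (forall v, Ck_on m U (fun x => 'D_v f x))
  else forall x, U x -> {for x, continuous f}.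

Definition smooth_on (U : set V) (f : V -> W) : Prop :=
  forall n, Ck_on n U f.

End Smoothness.

Definition diffeo_onto_image {R : realType} {V W : normedModType R}
    (U : set V) (f : V -> W) : Prop :=
  [/\ open U, open (f @` U), smooth_on U f &
      exists finv : W -> V,
        (forall y, U y -> finv (f y) = y) /\ smooth_on (f @` U) finv].

(* Charts are total functions that are meaningful on [chart_dom] only, and
   [chart_inv] is meaningful on the image of [chart_dom] only. *)
Record chart (R : realType) (N : nat) (M : topologicalType) := Chart {
  chart_dom : set M;
  chart_map : M -> 'rV[R]_N;
  chart_inv : 'rV[R]_N -> M;
  chart_dom_open : open chart_dom;
  chart_img_open : open (chart_map @` chart_dom);
  chart_mapK : forall x, chart_dom x -> chart_inv (chart_map x) = x;
  chart_map_cont : {within chart_dom, continuous chart_map};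
  chart_inv_cont : {within chart_map @` chart_dom, continuous chart_inv}
}.

Definition chart_img (R : realType) (N : nat) (M : topologicalType)
    (c : chart R N M) : set 'rV[R]_N :=
  chart_map c @` chart_dom c.

Definition transition (R : realType) (N : nat) (M : topologicalType)
    (c d : chart R N M) : 'rV[R]_N -> 'rV[R]_N :=
  chart_map d \o chart_inv c.

Record smooth_manifold (R : realType) (N : nat) := SmoothManifold {
  carrier :> topologicalType;
  mfd_hausdorff : hausdorff_space carrier;
  mfd_second_countable : @second_countable carrier;
  chart_index : Type;
  atlas : chart_index -> chart R N carrier;
  atlas_cover : forall x : carrier, exists i, chart_dom (atlas i) x;
  atlas_smooth : forall i j,
    smooth_on (chart_map (atlas i) @`
                 (chart_dom (atlas i) `&` chart_dom (atlas j)))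
              (transition (atlas i) (atlas j))
}.

(* Signature (+,-,...,-): the form is diagonal with entries 1,-1,...,-1 in a
   suitable basis (the rows of [P]). *)
Definition lorentzian (R : realType) (N : nat) (A : 'M[R]_N) : Prop :=
  A^T = A /\
  exists2 P : 'M[R]_N, P \in unitmx &
    P *m A *m P^T = diag_mx (\row_(i < N) (if val i == 0%N then 1 else -1)).

(* Tensor fields are given by their components in every chart of the atlas,
   smooth in the coordinates and related by the usual transformation laws.
   With row vectors, [jacobian] has entries
   [jacobian tau z k l = d tau^l / d z^k]. *)
Record pseudo_metric (R : realType) (N : nat) (M : smooth_manifold R N) :=
  PseudoMetric {
  metric_at :> chart_index M -> M -> 'M[R]_N;
  metric_lorentzian : forall i x, chart_dom (atlas i) x ->
    lorentzian (metric_at i x);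
  metric_smooth : forall i,
    smooth_on (chart_img (atlas i))
              (fun z => metric_at i (chart_inv (atlas i) z));
  metric_transform : forall i j x,
    chart_dom (atlas i) x -> chart_dom (atlas j) x ->
    let Jac := jacobian (transition (atlas i) (atlas j))
                        (chart_map (atlas i) x) in
    metric_at i x = Jac *m metric_at j x *m Jac^T
}.

Record one_form (R : realType) (N : nat) (M : smooth_manifold R N) :=
  OneForm {
  form_at :> chart_index M -> M -> 'rV[R]_N;
  form_smooth : forall i,
    smooth_on (chart_img (atlas i))
              (fun z => form_at i (chart_inv (atlas i) z));
  form_transform : forall i j x,
    chart_dom (atlas i) x -> chart_dom (atlas j) x ->
    let Jac := jacobian (transition (atlas i) (atlas j))
                        (chart_map (atlas i) x) in
    form_at i x = form_at j x *m Jac^T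
}.

Record scalar_field (R : realType) (N : nat) (M : smooth_manifold R N) :=
  ScalarField {
  field_at :> M -> R;
  field_smooth : forall i,
    smooth_on (chart_img (atlas i))
              (fun z => field_at (chart_inv (atlas i) z))
}.

Definition bilin (R : realType) (N : nat) (A : 'M[R]_N) (u w : 'rV[R]_N) : R :=
  \sum_(i < N) \sum_(j < N) A i j * u 0 i * w 0 j.

Variant sector := timelike | spacelike.

Definition admissible (R : realType) (s : sector) (g : R) : Prop :=
  match s with
  | timelike => True
  | spacelike => -2 < g < 2
  end.

(* The tangent space at a fixed point, in the coordinate basis of a chart:
   [a] and [b] are the components a_ij and b_i, [g] the value of the scalar. *)
Section TangentSpace.
Context {R : realType} {N : nat}.
Context (a : 'M[R]_N) (b : 'rV[R]_N) (g : R) (s : sector).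
Implicit Types (y z : 'rV[R]_N).

Definition b_up : 'rV[R]_N :=
  \row_(i < N) \sum_(j < N) invmx a i j * b 0 j.

Definition b_of y : R := \sum_(i < N) b 0 i * y 0 i.

Definition r_form : 'M[R]_N := \matrix_(i, j) (a i j + b 0 i * b 0 j).

Definition gam y : R := bilin r_form y y.

Definition q_of y : R := Num.sqrt `|gam y|.

Definition B_of y : R := gam y - g * b_of y * q_of y - b_of y ^+ 2.

Definition sector_set : set 'rV[R]_N :=
  match s with
  | timelike => [set y | 0 < gam y /\ 0 < B_of y]
  | spacelike => [set y | gam y < 0]
  end.

Definition h_of : R :=
  match s with
  | timelike => Num.sqrt (1 + g ^+ 2 / 4)
  | spacelike => Num.sqrt (1 - g ^+ 2 / 4)
  end.

Definition G_of : R := g / h_of.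

Definition g_plus : R := - (g / 2) + h_of.

Definition g_minus : R := - (g / 2) - h_of.

Definition L_of y : R := q_of y + g / 2 * b_of y.

Definition f_of y : R :=
  if b_of y < 0 then - atan (G_of / 2) + atan (L_of y / (h_of * b_of y))
  else if 0 < b_of y then
    - pi - atan (G_of / 2) + atan (L_of y / (h_of * b_of y))
  else - (pi / 2) - atan (G_of / 2).

Definition J_of y : R :=
  match s with
  | timelike =>
      ((b_of y - g_minus * q_of y) / (g_plus * q_of y - b_of y))
        `^ (- (G_of / 4))
  | spacelike => expR (- (G_of / 2) * f_of y)
  end.

(* [F2] is the square of the metric function; it is negative on the space-like
   sector. *)
Definition F2 y : R := B_of y * J_of y ^+ 2.

Definition finsler_metric y : 'M[R]_N :=
  \matrix_(i, j)
    (2^-1 * 'D_(delta_mx 0 i) (fun z => 'D_(delta_mx 0 j) F2 z) y).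

Definition varkappa y : R := h_of^-1 * `|F2 y| `^ ((1 - h_of) / 2).

Definition v_of y : 'rV[R]_N := y + b_of y *: b_up.

Definition zeta y : 'rV[R]_N :=
  (J_of y / (varkappa y * h_of)) *:
    (h_of *: v_of y - (b_of y + g / 2 * q_of y) *: b_up).

Definition S2 z : R := bilin a z z.

Definition p_of z : R := (h_of ^+ 2)^-1 * `|S2 z| `^ ((1 - h_of) / h_of).

Definition factor_metric z : 'M[R]_N := p_of z *: a.

End TangentSpace.

(* Main.v *)
Require Import Defs.
From HB Require Import structures.
From mathcomp Require Import all_boot all_order all_algebra.
From mathcomp Require Import all_classical all_reals all_analysis.
From mathcomp Require Import ring lra.
Import Order.TTheory GRing.Theory Num.Theory.
Import numFieldNormedType.Exports.
Set Implicit Arguments.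
Unset Strict Implicit.
Unset Printing Implicit Defensive.
Local Open Scope classical_set_scope.
Local Open Scope ring_scope.

(** On both sectors everything is governed by x = (b + g q / 2) / (h q): with the
    sign e = 1 (time-like) or e = -1 (space-like) one has gamma = e q^2,
    h^2 = 1 + e g^2 / 4 and B = h^2 q^2 (e - x^2), while J is a function of x
    alone with J' / J = - (G / 2) / (e - x^2); in the space-like sector the three
    branches of f are one smooth function, f = - pi / 2 - arctan x.
    Writing lam = J / (varkappa h), the map multiplies the (v, b)-components as
    v -> lam h v and b -> lam (b + g q / 2). Hence b(zeta) / q(zeta) = x, and
    S^2(zeta) = lam^2 B has absolute value |F^2|^h, so that x and lam, and with
    them y, are recovered from zeta; the image is the sector with g = 0.
    For the metrics, D_w F^2 = 2 J^2 (r(y, w) - (b + g q) b(w)) and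
    p(zeta) = varkappa^2 reduce the isometry to a rational identity. *)

(** * Calculus of smooth maps *)

Section Differentiation.
Context {R : realType} {V W : normedModType R}.

(** The difference [g - f] vanishes near [x], so it is differentiable there with zero differential;
    adding [f] back gives [g]. *)
Lemma near_eq_differentiable (f g : V -> W) x :
  {near x, f =1 g} -> differentiable f x -> differentiable g x.
Proof.
move=> fg df.
have gx : (g - f) x = 0.
  by rewrite !fctE -(nbhs_singleton fg) subrr.
have dz : (g - f) \o shift x = cst ((g - f) x) + (\0 : V -> W) +o_ 0 id.
  apply/eqaddoP => e e0.
  have : \forall y \near 0, f (y + x) = g (y + x).
    by move: fg; rewrite (near_shift 0 x) /= subr0.
  apply: filterS => y fgy.
  by rewrite gx !fctE /= fgy subrr !addr0 subr0 normr0 mulr_ge0// ltW.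
have dzf : differentiable (g - f) x.
  apply/diff_locallyP; rewrite (diff_unique _ dz)//; last exact: cst_continuous.
  by split=> //; exact: cst_continuous.
by rewrite -(subrK f g); exact: differentiableD.
Qed.

Lemma is_diff_derive (f df : V -> W) x v : is_diff x f df -> 'D_v f x = df v.
Proof. by move=> dfx; rewrite deriveE// diff_val. Qed.

Lemma is_diff_derivable (f df : V -> R) x : is_diff x f df ->
  forall (phi : R -> R) (d : R), is_derive (f x) 1 phi d ->
  is_diff x (fun z => phi (f z)) (fun v => d * df v).
Proof.
move=> dfx phi d [phid <-].
have dphi : is_diff (f x) phi (fun t => t *: 'D_1 phi (f x)).
  apply: DiffDef; first exact/derivable1_diffP.
  by rewrite deriv1E// derive1E.
apply: is_diff_eq (is_diff_comp dfx dphi) _.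
by apply/funext => v /=; rewrite mulrC.
Qed.

Lemma is_diff_sum (I : finType) (f df : I -> V -> W) x :
  (forall i, is_diff x (f i) (df i)) ->
  is_diff x (fun z => \sum_i f i z) (fun v => \sum_i df i v).
Proof.
move=> dfx; elim: (index_enum I) => [|i s IH].
  have -> : (fun z => \sum_(i <- [::]) f i z) = cst (0 : W).
    by apply/funext => z; rewrite big_nil.
  apply: is_diff_eq (is_diff_cst _ _) _.
  by apply/funext => v; rewrite big_nil.
have -> : (fun z => \sum_(j <- i :: s) f j z) = f i + (fun z => \sum_(j <- s) f j z).
  by apply/funext => z; rewrite big_cons.
apply: is_diff_eq (is_diffD (dfx i) IH) _.
by apply/funext => v; rewrite big_cons.
Qed.

Lemma is_diff_mul (f g df dg : V -> R) x :
  is_diff x f df -> is_diff x g dg ->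
  is_diff x (fun z => f z * g z) (fun v => f x * dg v + g x * df v).
Proof. by move=> dfx dgx; exact: is_diffM. Qed.

Lemma is_diff_add (f g df dg : V -> W) x :
  is_diff x f df -> is_diff x g dg ->
  is_diff x (fun z => f z + g z) (fun v => df v + dg v).
Proof. by move=> dfx dgx; exact: is_diffD. Qed.

Lemma is_diff_scalev (k dk : V -> R) (w : W) x :
  is_diff x k dk -> is_diff x (fun z => k z *: w) (fun v => dk v *: w).
Proof.
move=> dkx; apply: DiffDef; first exact: differentiableZl.
by rewrite diffZl// diff_val.
Qed.

(** Lets a formula with absolute values or case distinctions be replaced near the point by a smooth
    closed form. *)
Lemma is_diff_near (f g df : V -> W) x : {near x, f =1 g} ->
  is_diff x f df -> is_diff x g df.
Proof.
move=> fg dfx; have dg : differentiable g x by exact: near_eq_differentiable fg _.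
apply: DiffDef => //; apply/funext => v.
by rewrite -deriveE// -(is_diff_derive v dfx); apply/esym/near_eq_derive.
Qed.

End Differentiation.

Section RowVectors.
Context {R : realType} {N : nat}.

Lemma is_diff_coord (x : 'rV[R]_N) i :
  is_diff x (fun y : 'rV[R]_N => y 0 i) (fun v => v 0 i).
Proof.
pose f : 'rV[R]_N -> R := fun y => y 0 i.
have flin : linear f by move=> c u v; rewrite /f !mxE.
pose fL : {linear 'rV[R]_N -> R} :=
  HB.pack f (GRing.isLinear.Build _ _ _ _ _ flin).
have cf : continuous fL by exact: coord_continuous.
rewrite -[X in is_diff x X _]/(fL : _ -> _) -[X in is_diff x _ X]/(fL : _ -> _).
by apply: DiffDef; [exact: linear_differentiable|rewrite diff_lin].
Qed.

(** Coefficient and vector both vary, so [k z *: z] is expanded in the standard basis, where each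
    term is a scalar function times a fixed vector. *)
Lemma is_diff_scale_id (k dk : 'rV[R]_N -> R) x : is_diff x k dk ->
  is_diff x (fun z => k z *: z) (fun v => k x *: v + dk v *: x).
Proof.
move=> dkx.
have -> : (fun z => k z *: z) =
    (fun z => \sum_i (k z * z 0 i) *: (delta_mx 0 i : 'rV[R]_N)).
  apply/funext => z; rewrite {2}[z]row_sum_delta scaler_sumr.
  by apply: eq_bigr => i _; rewrite scalerA.
apply: is_diff_eq; first apply: is_diff_sum => i.
  by apply: is_diff_scalev; apply: is_diff_mul; exact: is_diff_coord.
apply/funext => v /=.
transitivity (k x *: (\sum_i v 0 i *: delta_mx 0 i : 'rV[R]_N) +
    dk v *: (\sum_i x 0 i *: delta_mx 0 i : 'rV[R]_N)); last by rewrite -!row_sum_delta.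
rewrite !scaler_sumr -big_split; apply: eq_bigr => i _ /=.
by rewrite !scalerA -scalerDl; congr (_ *: _); rewrite [x 0 i * _]mulrC.
Qed.

End RowVectors.

(** * Closure properties of C^n functions on an open set *)

Section CkCalculus.
Context {R : realType} {V : normedModType R}.
Context (U : set V).
Context (oU : open U).

(** As [U] is open, equality on [U] is equality near each of its points, so it passes to every
    directional derivative. *)
Lemma Ck_on_ext (W : normedModType R) n (f g : V -> W) :
  (forall x, U x -> f x = g x) -> Ck_on n U f -> Ck_on n U g.
Proof.
have nU x : U x -> \forall y \near x, U y by move=> Ux; exact: open_nbhs_nbhs.
elim: n f g => [|n IH] f g fg /=.
  move=> cf x Ux; rewrite /prop_for /continuous_at -fg//.
  apply: cvg_trans (cf x Ux); apply: near_eq_cvg.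
  by apply: filterS (nU x Ux) => y Uy; rewrite fg.
move=> [df cf]; split=> [x Ux|v].
  apply: near_eq_differentiable (df x Ux).
  by apply: filterS (nU x Ux) => y Uy; rewrite fg.
apply: IH (cf v) => x Ux; apply: near_eq_derive.
by apply: filterS (nU x Ux) => y Uy; rewrite fg.
Qed.

(** The induction step of the calculus: an explicit differential with C^n components certifies
    C^(n+1). *)
Lemma Ck_on_is_diff (W : normedModType R) n (f : V -> W) (df : V -> V -> W) :
  (forall x, U x -> is_diff x f (df x)) ->
  (forall v, Ck_on n U (fun x => df x v)) -> Ck_on n.+1 U f.
Proof.
move=> dfx cdf; split=> [x Ux|v]; first by have := dfx x Ux => -[].
apply: Ck_on_ext (cdf v) => x Ux.
by have dfxU := dfx x Ux; rewrite (is_diff_derive v dfxU).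
Qed.

Lemma Ck_onS (W : normedModType R) n (f : V -> W) : Ck_on n.+1 U f -> Ck_on n U f.
Proof.
elim: n f => [|n IH] f [df cf].
  by move=> x Ux; apply: differentiable_continuous; exact: df.
by split=> // v; apply: IH; exact: cf.
Qed.

Lemma Ck_on_cst (W : normedModType R) n (c : W) : Ck_on n U (fun=> c).
Proof.
elim: n c => [|n IH] c; first by move=> x _; exact: cst_continuous.
by apply: (@Ck_on_is_diff _ _ _ (fun _ _ => 0)) => // x _; exact: is_diff_cst.
Qed.

Lemma Ck_onD (W : normedModType R) n (f g : V -> W) :
  Ck_on n U f -> Ck_on n U g -> Ck_on n U (fun x => f x + g x).
Proof.
elim: n f g => [|n IH] f g cf cg.
  by move=> x Ux; apply: cvgD; [exact: cf|exact: cg].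
apply: (@Ck_on_is_diff _ _ _ (fun x v => 'D_v f x + 'D_v g x)) => [x Ux|v]; last first.
  by apply: IH; [exact: cf.2|exact: cg.2].
have dfx := differentiableP (cf.1 x Ux); have dgx := differentiableP (cg.1 x Ux).
apply: is_diff_eq (is_diffD dfx dgx) _.
by apply/funext => v /=; rewrite (is_diff_derive v dfx) (is_diff_derive v dgx).
Qed.

Lemma Ck_onM n (f g : V -> R) :
  Ck_on n U f -> Ck_on n U g -> Ck_on n U (fun x => f x * g x).
Proof.
elim: n f g => [|n IH] f g cf cg.
  by move=> x Ux; apply: cvgM; [exact: cf|exact: cg].
apply: (@Ck_on_is_diff _ _ _ (fun x v => f x * 'D_v g x + g x * 'D_v f x))
    => [x Ux|v]; last first.
  (* The undifferentiated factors of the Leibniz rule are C^(n+1), and [Ck_onS] lowers them to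
     C^n. *)
  by apply: Ck_onD; apply: IH; do ?[exact: Ck_onS|exact: cf.2|exact: cg.2].
have dfx := differentiableP (cf.1 x Ux); have dgx := differentiableP (cg.1 x Ux).
apply: is_diff_eq (is_diffM dfx dgx) _.
by apply/funext => v /=; rewrite (is_diff_derive v dfx) (is_diff_derive v dgx).
Qed.

Lemma Ck_onZl (W : normedModType R) n (k : V -> R) (w : W) :
  Ck_on n U k -> Ck_on n U (fun x => k x *: w).
Proof.
elim: n k => [|n IH] k ck.
  by move=> x Ux; apply: cvgZr_tmp; exact: ck.
apply: (@Ck_on_is_diff _ _ _ (fun x v => 'D_v k x *: w)) => [x Ux|v]; last first.
  by apply: IH; exact: ck.2.
have dkx := ck.1 x Ux.
apply: DiffDef; first exact: differentiableZl.
by rewrite diffZl//; apply/funext => v /=; rewrite deriveE.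
Qed.

Lemma Ck_on_sum (W : normedModType R) n (I : finType) (f : I -> V -> W) :
  (forall i, Ck_on n U (f i)) -> Ck_on n U (fun x => \sum_i f i x).
Proof.
move=> cf; elim: (index_enum I) => [|i s IH].
  apply: Ck_on_ext (@Ck_on_cst _ n 0) => x _; by rewrite big_nil.
by apply: Ck_on_ext (Ck_onD (cf i) IH) => x _; rewrite big_cons.
Qed.

(* The second hypothesis lets [phi'] be expressed through [phi] itself, so that
   a differential equation for [phi] yields smoothness by bootstrapping. *)
Lemma Ck_on_comp n (f : V -> R) (phi phi' : R -> R) :
  (forall x, U x -> is_derive (f x) 1 phi (phi' (f x))) ->
  (forall m, Ck_on m U f -> Ck_on m U (fun x => phi (f x)) ->
             Ck_on m U (fun x => phi' (f x))) ->
  Ck_on n U f -> Ck_on n U (fun x => phi (f x)).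
Proof.
move=> dphi boot; elim: n => [|n IH] cf.
  move=> x Ux; apply: (continuous_comp (cf x Ux)).
  have [dphix _] := dphi x Ux.
  by apply/differentiable_continuous/derivable1_diffP.
apply: (@Ck_on_is_diff _ _ _ (fun x v => phi' (f x) * 'D_v f x)) => [x Ux|v].
  have dfx := differentiableP (cf.1 x Ux).
  apply: is_diff_eq (is_diff_derivable dfx (dphi x Ux)) _.
  by apply/funext => v; rewrite (is_diff_derive v dfx).
have cfn := Ck_onS cf.
by apply: Ck_onM; [apply: boot => //; exact: IH|exact: cf.2].
Qed.

(** Bootstrapping with [phi' = - phi ^ 2]; the square root and the power below use
    [phi' = 1 / (2 phi)] and [phi' = c phi / t]. *)
Lemma Ck_onV n (f : V -> R) : (forall x, U x -> f x != 0) ->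
  Ck_on n U f -> Ck_on n U (fun x => (f x)^-1).
Proof.
move=> f0; apply: (@Ck_on_comp _ _ GRing.inv (fun t => - (t^-1 * t^-1))).
  move=> x Ux; apply: is_derive_eq (is_deriveV _ _) _ => //; first exact: f0.
  by rewrite [LHS]mulr1 -invfM -expr2.
move=> m _ cV; apply: Ck_on_ext (Ck_onM (Ck_on_cst m (-1 : R)) (Ck_onM cV cV)).
by move=> x _ /=; rewrite mulN1r.
Qed.

Lemma Ck_on_sqrt n (f : V -> R) : (forall x, U x -> 0 < f x) ->
  Ck_on n U f -> Ck_on n U (fun x => Num.sqrt (f x)).
Proof.
move=> f0; apply: (@Ck_on_comp _ _ Num.sqrt (fun t => (2 * Num.sqrt t)^-1)).
  by move=> x Ux; apply: is_derive1_sqrt; exact: f0.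
move=> m _ cs; apply: Ck_onV; last exact/(Ck_onM _ cs)/Ck_on_cst.
by move=> x Ux; rewrite mulf_neq0// gt_eqF// sqrtr_gt0 f0.
Qed.

Lemma Ck_on_powR n (c : R) (f : V -> R) : (forall x, U x -> 0 < f x) ->
  Ck_on n U f -> Ck_on n U (fun x => f x `^ c).
Proof.
move=> f0; apply: (@Ck_on_comp _ _ (@powR R ^~ c) (fun t => c * t `^ (c - 1))).
  by move=> x Ux; apply: is_derive1_powR; exact: f0.
move=> m cf cp.
have f_neq0 x : U x -> f x != 0 by move=> Ux; rewrite gt_eqF// f0.
apply: Ck_on_ext (Ck_onM (Ck_on_cst m c) (Ck_onM cp (Ck_onV f_neq0 cf))) => x Ux.
by rewrite /= powRB ?f_neq0 ?implybT// powRr1// ltW// f0.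
Qed.

End CkCalculus.

Lemma Ck_on_coord (R : realType) (N n : nat) (U : set 'rV[R]_N) (i : 'I_N) :
  open U -> Ck_on n U (fun y : 'rV[R]_N => y 0 i).
Proof.
move=> oU; case: n => [|n]; first by move=> x _; exact: coord_continuous.
apply: (Ck_on_is_diff oU (df := fun _ v => v 0 i)) => [x _|v].
  exact: is_diff_coord.
exact: Ck_on_cst.
Qed.

Section MoreCalculus.
Context {R : realType} {V : normedModType R}.
Implicit Types (U : set V) (f g df dg : V -> R) (x : V).

Lemma is_diff_const x (c : R) : is_diff x (fun=> c : R) (fun=> 0).
Proof. exact: is_diff_cst. Qed.

Lemma is_diff_opp f df x : is_diff x f df -> is_diff x (fun z => - f z) (fun v => - df v).
Proof. by move=> dfx; exact: is_diffN. Qed.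

Lemma is_diff_inv f df x : f x != 0 -> is_diff x f df ->
  is_diff x (fun z => (f z)^-1) (fun v => - (f x) ^- 2 * df v).
Proof.
move=> fx0 dfx; apply: is_diff_derivable.
apply: is_derive_eq (is_deriveV (f := id) fx0 (is_derive_id _ _)) _.
by rewrite [LHS]mulr1.
Qed.

Lemma Ck_onB n U f g : open U ->
  Ck_on n U f -> Ck_on n U g -> Ck_on n U (fun x => f x - g x).
Proof.
move=> oU cf cg; apply: (Ck_onD oU cf).
apply: (Ck_on_ext oU) (Ck_onM oU (Ck_on_cst oU n (-1 : R)) cg) => x _ /=.
by rewrite mulN1r.
Qed.

Lemma Ck_on_sqr n U f : open U ->
  Ck_on n U f -> Ck_on n U (fun x => f x ^+ 2).
Proof.
by move=> oU cf; apply: (Ck_on_ext oU) (Ck_onM oU cf cf) => x _; rewrite expr2.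
Qed.

Lemma open_pos U f : open U -> Ck_on 0 U f -> open [set x | U x /\ 0 < f x].
Proof.
move=> oU cf; rewrite openE => x [Ux fx]; apply: filterI.
  exact: open_nbhs_nbhs.
exact: (cvgr_gt _ (cf x Ux)).
Qed.

End MoreCalculus.

Lemma Ck_on_scale_id (R : realType) (N n : nat) (U : set 'rV[R]_N) (k : 'rV[R]_N -> R) :
  open U -> Ck_on n U k -> Ck_on n U (fun y => k y *: y).
Proof.
move=> oU ck.
have H := Ck_on_sum oU (fun i => Ck_onZl oU (delta_mx 0 i : 'rV[R]_N)
  (Ck_onM oU ck (Ck_on_coord n i oU))).
apply: (Ck_on_ext oU) H => y _.
transitivity (k y *: (\sum_i y 0 i *: delta_mx 0 i : 'rV[R]_N)); last first.
  by rewrite -row_sum_delta.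
by rewrite scaler_sumr; apply: eq_bigr => i _; rewrite scalerA.
Qed.

(** * Bilinear forms and an arctangent identity *)

Section Bilinear.
Context {R : realType} {N : nat}.
Implicit Types (A : 'M[R]_N) (u v w : 'rV[R]_N).

Lemma bilinE A u w : bilin A u w = (u *m A *m w^T) 0 0.
Proof.
rewrite /bilin mxE exchange_big; apply: eq_bigr => j _ /=.
rewrite !mxE big_distrl /=; apply: eq_bigr => i _.
by rewrite [u 0 i * _]mulrC.
Qed.

Lemma bilinDl A u v w : bilin A (u + v) w = bilin A u w + bilin A v w.
Proof. by rewrite !bilinE !mulmxDl mxE. Qed.

Lemma bilinZl A k u w : bilin A (k *: u) w = k * bilin A u w.
Proof. by rewrite !bilinE -!scalemxAl mxE. Qed.

Lemma bilinDr A u v w : bilin A u (v + w) = bilin A u v + bilin A u w.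
Proof. by rewrite !bilinE linearD mulmxDr mxE. Qed.

Lemma bilinZr A k u w : bilin A u (k *: w) = k * bilin A u w.
Proof. by rewrite !bilinE linearZ -!scalemxAr mxE. Qed.

Lemma bilinC A u w : A^T = A -> bilin A u w = bilin A w u.
Proof.
move=> sA; rewrite !bilinE -[in LHS](trmxK (_ *m _ *m _)) mxE.
by rewrite !trmx_mul trmxK sA mulmxA.
Qed.

Lemma bilin_scale A k u w : bilin (k *: A) u w = k * bilin A u w.
Proof. by rewrite !bilinE -scalemxAr -scalemxAl mxE. Qed.

(** A bilinear map is determined by its values on the basis; this serves to evaluate the Hessian
    matrix [finsler_metric] at arbitrary vectors. *)
Lemma bilin_delta (H : 'rV[R]_N -> 'rV[R]_N -> R) u w :
  (forall w, linear_for *%R (H^~ w)) -> (forall u, linear_for *%R (H u)) ->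
  bilin (\matrix_(i, j) H (delta_mx 0 i) (delta_mx 0 j)) u w = H u w.
Proof.
move=> Hl Hr.
have suml (f : 'rV[R]_N -> R) v : linear_for *%R f ->
    f v = \sum_i f (delta_mx 0 i) * v 0 i.
  move=> fl.
  (* Coefficient [-1] at zero vectors turns the linearity equation into [f 0 = 0]. *)
  have f0 : f 0 = 0 by have := fl (-1) 0 0; rewrite scaler0 addr0 mulN1r addNr.
  have fsum s : f (\sum_(i <- s) v 0 i *: delta_mx 0 i) =
      \sum_(i <- s) f (delta_mx 0 i) * v 0 i.
    elim: s => [|i s IH]; first by rewrite !big_nil.
    by rewrite !big_cons fl IH mulrC.
  by rewrite {1}[v]row_sum_delta fsum.
rewrite (suml (H^~ w))// /bilin; apply: eq_bigr => i _.
rewrite (suml (H _) w)// mulr_suml; apply: eq_bigr => j _.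
by rewrite mxE mulrAC.
Qed.

End Bilinear.

(** * A quarter-turn relation between arctangents *)

Section AtanIdentity.
Context {R : realType}.
Implicit Types (b g h q x : R).

Lemma sin_atan x : sin (atan x) = x * cos (atan x).
Proof.
have c0 : cos (atan x) != 0.
  by apply/lt0r_neq0/cos_gt0_pihalf; rewrite atan_gtNpi2 atan_ltpi2.
by rewrite -{2}(atanK x) /tan divfK.
Qed.

Lemma cos_atan_gt0 x : 0 < cos (atan x).
Proof. by apply: cos_gt0_pihalf; rewrite atan_gtNpi2 atan_ltpi2. Qed.

(* The two arguments of the arctangent are those of [f_of] and of its branch-free
   form: they are images of each other under a quarter turn. *)
Lemma atan_quarter_turn_neg b g h q : 0 < h -> 0 < q -> b < 0 ->
  h ^+ 2 = 1 - g ^+ 2 / 4 ->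
  atan ((q + g / 2 * b) / (h * b)) =
  atan (g / h / 2) - atan ((b + g / 2 * q) / (h * q)) - pi / 2.
Proof.
move=> h0 q0 b0 h2.
set al := atan (g / h / 2); set be := atan ((b + g / 2 * q) / (h * q)).
have hn : h != 0 by rewrite gt_eqF. have qn : q != 0 by rewrite gt_eqF.
have bn : b != 0 by rewrite lt_eqF.
(* The arguments of [be] and [al] differ by [b / (h q) < 0]; together with [al - be < pi] this puts
   [al - be - pi / 2] in the interval where [tan] can be inverted. *)
have ltba : be < al.
  apply: lt_atan.
  have -> : (b + g / 2 * q) / (h * q) = g / h / 2 + b / (h * q).
    by field; rewrite hn qn.
  by rewrite gtrDl pmulr_llt0 ?invr_gt0 ?mulr_gt0.
have hi : al - be < pi.
  have := atan_ltpi2 (g / h / 2); have := atan_gtNpi2 ((b + g / 2 * q) / (h * q)).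
  rewrite -/al -/be; lra.
have tin : al - be - pi / 2 \in `](- (pi / 2)), (pi / 2)[.
  rewrite in_itv /=; apply/andP; split; lra.
rewrite -[RHS](tanK tin); congr atan.
rewrite /tan sinBpihalf cosBpihalf sinB cosB !sin_atan -/al -/be.
set ca := cos al; set cb := cos be.
have ca0 : ca != 0 by rewrite gt_eqF// cos_atan_gt0.
have cb0 : cb != 0 by rewrite gt_eqF// cos_atan_gt0.
have g2 : g ^+ 2 = 4 * (1 - h ^+ 2) by rewrite h2; field.
(* This is [cos (al - be)], and the next rewriting treats [sin (al - be)]; the relation between [g]
   and [h] reduces [h ^ 2 q + g ^ 2 q / 4] to [q]. *)
have -> : ca * cb + g / h / 2 * ca * ((b + g / 2 * q) / (h * q) * cb) =
    ca * cb * (q + g / 2 * b) / (h ^+ 2 * q) by field: g2; rewrite hn qn.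
have -> : g / h / 2 * ca * cb - ca * ((b + g / 2 * q) / (h * q) * cb) =
    - (ca * cb * b) / (h * q) by field; rewrite hn qn.
by field; rewrite hn bn qn ca0 cb0.
Qed.

(** Follows from the case [b < 0] by the symmetry [(b, g) -> (- b, - g)], which negates all three
    arguments of [atan]. *)
Lemma atan_quarter_turn_pos b g h q : 0 < h -> 0 < q -> 0 < b ->
  h ^+ 2 = 1 - g ^+ 2 / 4 ->
  atan ((q + g / 2 * b) / (h * b)) =
  atan (g / h / 2) - atan ((b + g / 2 * q) / (h * q)) + pi / 2.
Proof.
move=> h0 q0 b0 h2.
have hn : h != 0 by rewrite gt_eqF. have qn : q != 0 by rewrite gt_eqF.
have bn : b != 0 by rewrite gt_eqF.
have := @atan_quarter_turn_neg (- b) (- g) h q h0 q0.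
rewrite oppr_lt0 sqrrN => /(_ b0 h2).
have -> : (q + - g / 2 * - b) / (h * - b) = - ((q + g / 2 * b) / (h * b)).
  by field; rewrite hn bn.
have -> : - g / h / 2 = - (g / h / 2) by field.
have -> : (- b + - g / 2 * q) / (h * q) = - ((b + g / 2 * q) / (h * q)).
  by field; rewrite hn qn.
rewrite !atanN; lra.
Qed.

End AtanIdentity.

(** * The function J *)

Section Sector.
Context {R : realType}.
Implicit Types (s : sector) (g h x : R).

Definition sector_sign s : R := if s is timelike then 1 else -1.

Lemma sector_sign_sqr s : sector_sign s ^+ 2 = 1.
Proof. by case: s; rewrite /= ?sqrrN expr1n. Qed.

Lemma h_of_gt0 g s : admissible s g -> 0 < h_of g s.
Proof. by case: s => /= H; rewrite sqrtr_gt0; nra. Qed.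

Lemma h_of_sqr g s : admissible s g ->
  h_of g s ^+ 2 = 1 + sector_sign s * (g ^+ 2 / 4).
Proof.
by case: s => /= H; rewrite sqr_sqrtr ?mul1r ?mulN1r//; nra.
Qed.

(* [J_of] as a function of [x = (b + g q / 2) / (h q)] alone. *)
Definition J_fun g s x : R :=
  match s with
  | timelike => ((1 + x) / (1 - x)) `^ (- (G_of g s / 4))
  | spacelike => expR (G_of g s / 2 * (pi / 2 + atan x))
  end.

Lemma sector_arg_lt1 x : 0 < 1 - sector_sign timelike * x ^+ 2 -> -1 < x < 1.
Proof. by rewrite /= mul1r => H; apply/andP; split; nra. Qed.

Lemma J_fun_gt0 g s x : 0 < 1 - sector_sign s * x ^+ 2 -> 0 < J_fun g s x.
Proof.
case: s => /= [/sector_arg_lt1/andP[x1 x2]|_]; last exact: expR_gt0.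
by rewrite powR_gt0// divr_gt0; lra.
Qed.

(** The logarithm of [(1 + x) / (1 - x)] has derivative [2 / (1 - x ^ 2)], and [atan] has
    [1 / (1 + x ^ 2)]; the sign of the sector merges the two cases. *)
Lemma is_derive_J_fun g s x : 0 < 1 - sector_sign s * x ^+ 2 ->
  is_derive x 1 (J_fun g s)
    (- (G_of g s / 2) / (sector_sign s - x ^+ 2) * J_fun g s x).
Proof.
case: s => [xd|_]; last first.
  have dl : is_derive x 1 (fun t => G_of g spacelike / 2 * (pi / 2 + atan t))
      (G_of g spacelike / 2 * (1 + x ^+ 2)^-1).
    have da := is_deriveD (is_derive_cst (pi / 2 : R) x 1) (is_derive1_atan x).
    by apply: is_derive_eq (is_deriveZ (G_of g spacelike / 2) da) _; rewrite add0r.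
  apply: is_derive_eq (is_derive1_comp _ dl) _ => /=.
  have x0 : 1 + x ^+ 2 != 0 by rewrite gt_eqF//; nra.
  rewrite [LHS]mulrC; field.
  by rewrite x0 andbT -opprD oppr_eq0.
have /andP[x1 x2] := sector_arg_lt1 xd.
have xn : 1 - x != 0 by rewrite gt_eqF//; lra.
have xp : 1 + x != 0 by rewrite gt_eqF//; lra.
have f0 : 0 < (1 + x) / (1 - x) by rewrite divr_gt0; lra.
have dl : is_derive x 1 (fun t => (1 + t) / (1 - t)) (2 / (1 - x) ^+ 2).
  have d1 : is_derive x 1 (fun t : R => 1 - t) (-1).
    have := is_deriveB (is_derive_cst (1 : R) x 1) (is_derive_id x 1).
    by rewrite sub0r.
  have d2 : is_derive x 1 (fun t : R => 1 + t) 1.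
    have := is_deriveD (is_derive_cst (1 : R) x 1) (is_derive_id x 1).
    by rewrite add0r.
  have d3 := is_deriveV (f := fun t => 1 - t) xn d1.
  apply: is_derive_eq (is_deriveM d2 d3) _.
  by rewrite /GRing.scale /=; field.
have dp := is_derive1_powR (- (G_of g timelike / 4)) f0.
apply: is_derive_eq (is_derive1_comp (g := fun t => (1 + t) / (1 - t)) dp dl) _.
rewrite /=.
rewrite powRB; last by rewrite (gt_eqF f0) implybT.
rewrite powRr1 ?ltW//; field.
rewrite xn xp andbT /=.
have -> : 1 - x ^+ 2 = (1 - x) * (1 + x) by ring.
by rewrite mulf_neq0.
Qed.

(** The differential equation of [J_fun] expresses its derivative as a rational function times
    [J_fun], so [Ck_on_comp] bootstraps. *)
Lemma Ck_on_J_fun (V : normedModType R) n (U : set V) (f : V -> R) g s :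
  open U -> (forall y, U y -> 0 < 1 - sector_sign s * f y ^+ 2) ->
  Ck_on n U f -> Ck_on n U (fun y => J_fun g s (f y)).
Proof.
move=> oU fU; apply: (@Ck_on_comp _ _ _ oU _ _ (J_fun g s)
  (fun t => - (G_of g s / 2) / (sector_sign s - t ^+ 2) * J_fun g s t)).
  by move=> y Uy; apply: is_derive_J_fun; exact: fU.
move=> m cf cJ; apply: (Ck_onM oU _ cJ); apply: (Ck_onM oU) => //.
  exact: Ck_on_cst.
apply: (Ck_onV oU) => [y Uy|].
  have := fU y Uy; have := sector_sign_sqr s; rewrite expr2.
  (* If [e] were the square of [f y], then [1 - e * f y ^ 2] would be [1 - e ^ 2 = 0]. *)
  set e := sector_sign s => e2 H; apply/negP => /eqP /subr0_eq E.
  by move: H; rewrite -E e2 subrr ltxx.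
apply: (Ck_onD oU); first exact: Ck_on_cst.
apply: (Ck_on_ext oU) (Ck_onM oU (Ck_on_cst oU m (-1 : R)) (Ck_onM oU cf cf)).
by move=> y _; rewrite /= mulN1r.
Qed.

End Sector.

(** * The map zeta and its inverse *)

Section TangentAlgebra.
Context {R : realType} {N : nat} (a : 'M[R]_N) (b : 'rV[R]_N).
Context (a_sym : a^T = a) (a_unit : a \in unitmx).
Context (b_norm : bilin (invmx a) b b = -1).
Implicit Types (u v w y z : 'rV[R]_N) (g : R) (s : sector).
Local Notation b_ := (b_of b).
Local Notation up := (b_up a b).
Local Notation r := (bilin (r_form a b)).
Local Notation gam := (gam a b).
Local Notation q := (q_of a b).

Lemma b_ofD u v : b_ (u + v) = b_ u + b_ v.
Proof. by rewrite /b_of -big_split; apply: eq_bigr => i _; rewrite mxE mulrDr. Qed.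

Lemma b_ofZ k u : b_ (k *: u) = k * b_ u.
Proof. by rewrite /b_of mulr_sumr; apply: eq_bigr => i _; rewrite mxE mulrCA. Qed.

Lemma b_ofE u : b_ u = (b *m u^T) 0 0.
Proof. by rewrite mxE; apply: eq_bigr => i _; rewrite mxE. Qed.

Lemma b_upE : up = b *m invmx a.
Proof.
apply/rowP => i; rewrite !mxE; apply: eq_bigr => j _.
by rewrite -{1}a_sym -trmx_inv mxE mulrC.
Qed.

Lemma bilin_up w : bilin a up w = b_ w.
Proof. by rewrite bilinE b_upE mulmxKV// b_ofE. Qed.

Lemma b_of_up : b_ up = -1.
Proof.
rewrite -b_norm b_ofE bilinE b_upE trmx_mul trmx_inv a_sym.
by rewrite mulmxA.
Qed.

Lemma r_formE u w : r u w = bilin a u w + b_ u * b_ w.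
Proof.
rewrite /bilin /b_of mulr_suml -big_split; apply: eq_bigr => i _ /=.
rewrite mulr_sumr -big_split; apply: eq_bigr => j _ /=.
by rewrite mxE; ring.
Qed.

Lemma r_formC u w : r u w = r w u.
Proof. by rewrite !r_formE bilinC// mulrC. Qed.

(** The normalisation [b_ up = -1] puts [up] in the kernel of [r], so [gam] and [q] do not change
    when a multiple of [up] is added. *)
Lemma r_form_up w : r up w = 0.
Proof. by rewrite r_formE bilin_up b_of_up mulN1r subrr. Qed.

Lemma bilin_r u w : bilin a u w = r u w - b_ u * b_ w.
Proof. by rewrite r_formE addrK. Qed.

(** The map [zeta], its inverse and its differential all produce combinations [k *: u + l *: up];
    this and the next lemmas give their invariants. *)
Lemma b_of_comb k l u : b_ (k *: u + l *: up) = k * b_ u - l.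
Proof. by rewrite b_ofD !b_ofZ b_of_up mulrN1. Qed.

Lemma r_form_comb k l m n u w :
  r (k *: u + l *: up) (m *: w + n *: up) = k * m * r u w.
Proof.
rewrite bilinDl !bilinZl r_form_up mulr0 addr0 bilinDr !bilinZr.
by rewrite [r u up]r_formC r_form_up mulr0 addr0 mulrA.
Qed.

Lemma gam_comb k l u : gam (k *: u + l *: up) = k ^+ 2 * gam u.
Proof. by rewrite /gam r_form_comb expr2. Qed.

Lemma q_of_comb k l u : 0 <= k -> q (k *: u + l *: up) = k * q u.
Proof.
move=> k0; rewrite /q_of gam_comb normrM (ger0_norm (sqr_ge0 k)).
by rewrite sqrtrM ?sqr_ge0// sqrtr_sqr (ger0_norm k0).
Qed.

(* The cone on which [q] is smooth; unlike the sectors it does not depend on [g]. *)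
Definition gam_cone s : set 'rV[R]_N := [set y | 0 < sector_sign s * gam y].

Definition J_arg g s y : R := (b_ y + g / 2 * q y) / (h_of g s * q y).

Lemma S2E z : S2 a z = gam z - b_ z ^+ 2.
Proof. by rewrite /S2 bilin_r expr2. Qed.

Section FixedSector.
Context (g : R) (s : sector) (g_adm : admissible s g).
Local Notation e := (@sector_sign R s).
Local Notation h := (h_of g s).
Local Notation Bf := (B_of a b g).
Local Notation x_ := (J_arg g s).

(** On the cone the absolute value is multiplication by the sign, which shows [q] as the root of a
    positive quadratic form. *)
Lemma q_of_cone y : gam_cone s y -> q y = Num.sqrt (e * gam y).
Proof.
by rewrite /gam_cone /q_of; case: s => /= H;
  [rewrite gtr0_norm; rewrite mul1r in H *
  |rewrite ltr0_norm ?mulN1r//; rewrite mulN1r oppr_gt0 in H].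
Qed.

Lemma q_of_gt0 y : gam_cone s y -> 0 < q y.
Proof. by move=> Cy; rewrite q_of_cone// sqrtr_gt0. Qed.

Lemma gamE y : gam_cone s y -> gam y = e * q y ^+ 2.
Proof.
move=> Cy; rewrite q_of_cone// sqr_sqrtr; last exact: ltW.
by rewrite mulrA -expr2 sector_sign_sqr mul1r.
Qed.

(** Completing the square gives [B = e h ^ 2 q ^ 2 - (b + g q / 2) ^ 2], because
    [e h ^ 2 = e + g ^ 2 / 4]. *)
Lemma B_of_J_arg y : gam_cone s y ->
  Bf y = h ^+ 2 * q y ^+ 2 * (e - x_ y ^+ 2).
Proof.
move=> Cy; have q0 := q_of_gt0 Cy; have h0 := h_of_gt0 g_adm.
have h2 := h_of_sqr g_adm; have e2 := @sector_sign_sqr R s.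
rewrite /B_of gamE// /J_arg.
have hn : h != 0 by rewrite gt_eqF. have qn : q y != 0 by rewrite gt_eqF.
have -> : h ^+ 2 * q y ^+ 2 * (e - ((b_ y + g / 2 * q y) / (h * q y)) ^+ 2) =
  e * h ^+ 2 * q y ^+ 2 - (b_ y + g / 2 * q y) ^+ 2 by field; rewrite hn qn.
by rewrite h2; field: e2.
Qed.

(** A description common to both sectors: [B] has the sign of [e - x ^ 2], and on the space-like
    side [1 + x ^ 2 > 0] holds automatically. *)
Lemma sectorP y : sector_set a b g s y <->
  gam_cone s y /\ 0 < 1 - e * x_ y ^+ 2.
Proof.
have E : gam_cone s y -> 0 < e * Bf y <-> 0 < 1 - e * x_ y ^+ 2.
  move=> Cy; rewrite B_of_J_arg// mulrCA pmulr_rgt0; last first.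
    by rewrite mulr_gt0// exprn_gt0// ?q_of_gt0// h_of_gt0.
  by rewrite mulrBr -expr2 sector_sign_sqr.
move: E; rewrite /gam_cone; case: s => /=.
  by rewrite !mul1r => E; split=> -[gy By]; split => //; apply/E.
move=> _; rewrite mulN1r oppr_gt0; split=> [gy|[]//]; split => //.
by rewrite mulN1r opprK ltr_pwDl// sqr_ge0.
Qed.

Lemma sector_B_gt0 y : sector_set a b g s y -> 0 < e * Bf y.
Proof.
move=> /sectorP[Cy xy]; rewrite B_of_J_arg//.
have -> : e * (h ^+ 2 * q y ^+ 2 * (e - x_ y ^+ 2)) =
    h ^+ 2 * q y ^+ 2 * (e ^+ 2 - e * x_ y ^+ 2) by ring.
by rewrite sector_sign_sqr mulr_gt0// mulr_gt0// exprn_gt0// ?q_of_gt0// h_of_gt0.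
Qed.

(** Time-like: both linear factors of [B] are [h q] times [1 + x] or [1 - x]. Space-like: the
    quarter-turn identities absorb [atan (G / 2)] on each branch of [f_of]. *)
Lemma J_ofE y : sector_set a b g s y -> J_of a b g s y = J_fun g s (x_ y).
Proof.
move=> /sectorP[Cy]; have q0 := q_of_gt0 Cy; have h0 := h_of_gt0 g_adm.
have hn : h != 0 by rewrite gt_eqF. have qn : q y != 0 by rewrite gt_eqF.
move: (h_of_sqr g_adm) h0 hn; rewrite /J_of /J_fun.
case: s => h2 h0 hn.
  move=> /sector_arg_lt1/andP[x1 x2]; congr (_ `^ _).
  have -> : b_ y - g_minus g timelike * q y =
      h_of g timelike * q y * (1 + J_arg g timelike y).
    by rewrite /g_minus /J_arg; field; rewrite hn qn.
  have -> : g_plus g timelike * q y - b_ y =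
      h_of g timelike * q y * (1 - J_arg g timelike y).
    by rewrite /g_plus /J_arg; field; rewrite hn qn.
  field; rewrite hn qn /= andbT gt_eqF//; lra.
move=> _; congr expR.
suff -> : f_of a b g spacelike y = - (pi / 2 + atan (J_arg g spacelike y)).
  by ring.
rewrite /= mulN1r in h2.
rewrite /f_of /L_of /G_of; case: ltgtP => b0.
- by rewrite (atan_quarter_turn_neg h0 q0 b0 h2) /J_arg; ring.
- by rewrite (atan_quarter_turn_pos h0 q0 b0 h2) /J_arg; field.
(* At [b = 0] the argument [x] equals [G / 2], so the value of [f_of] prescribed by continuity
   fits. *)
rewrite /J_arg b0 add0r opprD; congr (_ - atan _).
by field; rewrite hn qn.
Qed.

Definition zeta_scale y : R := J_of a b g s y / (varkappa a b g s y * h).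

Lemma F2_gt0 y : sector_set a b g s y -> 0 < e * F2 a b g s y.
Proof.
move=> Uy; rewrite /F2 mulrA mulr_gt0 ?sector_B_gt0// exprn_gt0// J_ofE//.
by apply: J_fun_gt0; case/sectorP: Uy.
Qed.

Lemma varkappa_h y : varkappa a b g s y * h = `|F2 a b g s y| `^ ((1 - h) / 2).
Proof. by rewrite /varkappa mulrAC mulVf ?mul1r// gt_eqF// h_of_gt0. Qed.

Lemma F2_norm y : sector_set a b g s y ->
  `|F2 a b g s y| = e * F2 a b g s y.
Proof.
move=> /F2_gt0 /gtr0_norm <-; rewrite (normrM e).
by case: s; rewrite /= ?normrN1 ?normr1 mul1r.
Qed.

(** Division by [varkappa] flips the exponent, and resolving the absolute value leaves a power of
    the positive quantity [e * F2]. *)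
Lemma zeta_scaleE y : sector_set a b g s y ->
  zeta_scale y = J_of a b g s y * (e * F2 a b g s y) `^ ((h - 1) / 2).
Proof.
move=> Uy; rewrite /zeta_scale varkappa_h F2_norm// -powRN.
by congr (_ * _ `^ _); field.
Qed.

Lemma zeta_scale_gt0 y : sector_set a b g s y -> 0 < zeta_scale y.
Proof.
move=> Uy; rewrite zeta_scaleE// mulr_gt0 ?powR_gt0 ?F2_gt0// J_ofE//.
by apply: J_fun_gt0; case/sectorP: Uy.
Qed.

Lemma zetaE y : zeta a b g s y =
  (zeta_scale y * h) *: y +
  (zeta_scale y * (h * b_ y - (b_ y + g / 2 * q y))) *: up.
Proof.
rewrite /zeta /v_of -/(zeta_scale y) !scalerDr scalerN !scalerA -addrA -scalerBl.
by congr (_ + _ *: _); ring.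
Qed.

Lemma b_of_zeta y :
  b_ (zeta a b g s y) = zeta_scale y * (b_ y + g / 2 * q y).
Proof. by rewrite zetaE b_of_comb; ring. Qed.

Lemma q_of_zeta y : sector_set a b g s y ->
  q (zeta a b g s y) = zeta_scale y * h * q y.
Proof.
move=> Uy; rewrite zetaE q_of_comb// mulr_ge0// ltW ?zeta_scale_gt0//.
exact: h_of_gt0.
Qed.

Lemma gam_zeta y : gam (zeta a b g s y) = (zeta_scale y * h) ^+ 2 * gam y.
Proof. by rewrite zetaE gam_comb. Qed.

Lemma S2_zeta_B y : sector_set a b g s y ->
  S2 a (zeta a b g s y) = zeta_scale y ^+ 2 * Bf y.
Proof.
move=> /sectorP[Cy _]; rewrite S2E gam_zeta b_of_zeta /B_of gamE//.
have h2 := h_of_sqr g_adm; have e2 := @sector_sign_sqr R s.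
rewrite exprMn h2; by field: e2.
Qed.

(** With [lam] written as [J] times a power, [lam ^ 2 * B] is [F2] times [(e * F2) ^ (h - 1)]. *)
Lemma S2_zeta y : sector_set a b g s y ->
  e * S2 a (zeta a b g s y) = (e * F2 a b g s y) `^ h.
Proof.
move=> Uy; have F0 := F2_gt0 Uy; rewrite S2_zeta_B// zeta_scaleE//.
set F := e * _ in F0 *; rewrite exprMn -(powR_mulrn 2 (powR_ge0 F _)) -powRrM.
have -> : (h - 1) / 2 * 2 = h - 1 by field.
have -> : e * (J_of a b g s y ^+ 2 * F `^ (h - 1) * Bf y) = F * F `^ (h - 1).
  by rewrite /F /F2; ring.
rewrite -{1}[F]powRr1 ?ltW// -powRD; last by rewrite (gt_eqF F0) implybT.
by congr (_ `^ _); ring.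
Qed.

Lemma S2_norm_zeta y : sector_set a b g s y ->
  `|S2 a (zeta a b g s y)| = `|F2 a b g s y| `^ h.
Proof.
move=> Uy; rewrite F2_norm// -S2_zeta//.
have /gtr0_norm <- : 0 < e * S2 a (zeta a b g s y).
  by rewrite S2_zeta// powR_gt0// F2_gt0.
by rewrite (normrM e); case: s; rewrite /= ?normrN1 ?normr1 mul1r.
Qed.

(** Since [|S2|] is [|F2| ^ h], the exponent [(1 - h) / h] becomes [1 - h], twice the exponent in
    [varkappa]. *)
Lemma p_of_zeta y : sector_set a b g s y ->
  p_of a g s (zeta a b g s y) = varkappa a b g s y ^+ 2.
Proof.
move=> Uy; rewrite /p_of S2_norm_zeta// /varkappa exprMn exprVn; congr (_ * _).
rewrite -powRrM -[RHS]powR_mulrn ?powR_ge0// -powRrM; congr (_ `^ _).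
by field; rewrite gt_eqF// h_of_gt0.
Qed.

End FixedSector.

(** * The explicit inverse of zeta and its image *)

Section InverseMap.
Context (g : R) (s : sector) (g_adm : admissible s g).
Local Notation e := (@sector_sign R s).
Local Notation h := (h_of g s).

Lemma admissible0 : admissible s (0 : R).
Proof. by case: s => //=; apply/andP; split; lra. Qed.

(** For [g = 0] one has [h = 1], so within the cone the target sector is a condition on [b / q]
    alone. *)
Lemma J_arg0 z : J_arg 0 s z = b_ z / q z.
Proof.
rewrite /J_arg !mul0r addr0 /h_of expr0n /= mul0r.
by case: s; rewrite ?addr0 ?subr0 sqrtr1 mul1r.
Qed.

Lemma sector0P z : sector_set a b 0 s z <->
  gam_cone s z /\ 0 < 1 - e * (b_ z / q z) ^+ 2.
Proof. by rewrite -J_arg0; exact: (sectorP admissible0). Qed.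

Lemma J_arg_zeta y : sector_set a b g s y ->
  b_ (zeta a b g s y) / q (zeta a b g s y) = J_arg g s y.
Proof.
move=> Uy; rewrite b_of_zeta// q_of_zeta// /J_arg.
have l0 := zeta_scale_gt0 g_adm Uy; have h0 := h_of_gt0 g_adm.
have [Cy _] := (sectorP g_adm y).1 Uy; have q0 := q_of_gt0 Cy.
by field; rewrite !gt_eqF.
Qed.

Lemma zeta_sector0 y : sector_set a b g s y ->
  sector_set a b 0 s (zeta a b g s y).
Proof.
move=> Uy; apply/sector0P; rewrite J_arg_zeta//.
have [Cy xy] := (sectorP g_adm y).1 Uy; split => //.
rewrite /gam_cone /= gam_zeta mulrCA mulr_gt0// exprn_gt0// mulr_gt0//.
  exact: zeta_scale_gt0.
exact: h_of_gt0.
Qed.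

(** Recovers [lam] from [z = zeta y]: there [x] is [b_ z / q z], and [e * F2] is
    [(e * S2) ^ (1 / h)]. *)
Definition zeta_inv_scale z : R :=
  J_fun g s (b_ z / q z) * (e * S2 a z) `^ ((h - 1) / 2 / h).

(** Solves [lam h q(y) = q(z)] and [lam (b(y) + g q(y) / 2) = b(z)]; the coefficient of [up] is the
    one that [b_of_comb] forces. *)
Definition zeta_inv z : 'rV[R]_N :=
  (h * zeta_inv_scale z)^-1 *: z +
  ((h * zeta_inv_scale z)^-1 * b_ z -
   (b_ z / zeta_inv_scale z - g / 2 * (q z / (h * zeta_inv_scale z)))) *: up.

Lemma zetaK y : sector_set a b g s y -> zeta_inv (zeta a b g s y) = y.
Proof.
move=> Uy; have l0 := zeta_scale_gt0 g_adm Uy; have h0 := h_of_gt0 g_adm.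
have ms : zeta_inv_scale (zeta a b g s y) = zeta_scale g s y.
  rewrite /zeta_inv_scale J_arg_zeta// S2_zeta// zeta_scaleE// J_ofE//.
  rewrite -powRrM; congr (_ * _ `^ _).
  by field; rewrite gt_eqF.
rewrite /zeta_inv ms b_of_zeta q_of_zeta// {1}zetaE scalerDr !scalerA -addrA -scalerDl.
have -> : (h * zeta_scale g s y)^-1 * (zeta_scale g s y * h) = 1.
  by field; rewrite !gt_eqF.
rewrite scale1r -[RHS]addr0; congr (_ + _); rewrite -[RHS](scale0r up).
by congr (_ *: _); field; rewrite !gt_eqF.
Qed.

(** By construction [y] has [J_arg] equal to [b_ z / q z], which places it in the sector; the point
    is then that its scale is [m]. *)
Lemma zeta_invK z : sector_set a b 0 s z ->
  sector_set a b g s (zeta_inv z) /\ zeta a b g s (zeta_inv z) = z.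
Proof.
move=> /sector0P[Cz xz]; set y := zeta_inv z; set m := zeta_inv_scale z.
have h0 := h_of_gt0 g_adm; have q0 := q_of_gt0 Cz.
have e2 := @sector_sign_sqr R s.
have S0 : 0 < e * S2 a z.
  rewrite S2E (gamE Cz).
  have -> : e * (e * q z ^+ 2 - b_ z ^+ 2) =
      q z ^+ 2 * (1 - e * (b_ z / q z) ^+ 2) by field: e2; rewrite gt_eqF.
  by rewrite mulr_gt0// exprn_gt0.
have J0 : 0 < J_fun g s (b_ z / q z) by exact: J_fun_gt0.
have m0 : 0 < m by rewrite mulr_gt0// powR_gt0.
have hn : h != 0 by rewrite gt_eqF. have mn : m != 0 by rewrite gt_eqF.
have qn : q z != 0 by rewrite gt_eqF.
have by_ : b_ y = b_ z / m - g / 2 * (q z / (h * m)).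
  by rewrite /y /zeta_inv b_of_comb -/m; ring.
have qy : q y = q z / (h * m).
  by rewrite /y /zeta_inv q_of_comb -/m 1?mulrC// invr_ge0 mulr_ge0 ?ltW.
have Cy : gam_cone s y.
  rewrite /gam_cone /= /y /zeta_inv gam_comb mulrCA mulr_gt0//.
  by rewrite exprn_gt0// invr_gt0 mulr_gt0.
have xy : J_arg g s y = b_ z / q z.
  by rewrite /J_arg by_ qy; field; rewrite hn mn qn.
have Uy : sector_set a b g s y by apply/(sectorP g_adm); rewrite xy.
split => //.
have ly : zeta_scale g s y = m.
  rewrite zeta_scaleE// J_ofE// xy /m /zeta_inv_scale; congr (_ * _).
  (* Here [F2 y] is [S2 z] divided by [(m / J) ^ 2], and the exponents combine as
     [1 - (h - 1) / h = 1 / h]. *)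
  have -> : e * F2 a b g s y = (e * S2 a z) `^ h^-1.
    rewrite /F2 J_ofE// (B_of_J_arg g_adm Cy) xy qy.
    have -> : e * (h ^+ 2 * (q z / (h * m)) ^+ 2 * (e - (b_ z / q z) ^+ 2) *
         J_fun g s (b_ z / q z) ^+ 2) = e * S2 a z / (m / J_fun g s (b_ z / q z)) ^+ 2.
      by rewrite S2E (gamE Cz); field; rewrite hn mn qn gt_eqF.
    have -> : m / J_fun g s (b_ z / q z) = (e * S2 a z) `^ ((h - 1) / 2 / h).
      by rewrite /m /zeta_inv_scale mulrAC mulfV ?mul1r// gt_eqF.
    rewrite -powR_mulrn ?powR_ge0// -powRrM -{1}[e * S2 a z]powRr1 ?ltW//.
    rewrite -powRB; last by rewrite (gt_eqF S0) implybT.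
    by congr (_ `^ _); field.
  by rewrite -powRrM; congr (_ `^ _); field.
rewrite zetaE ly by_ qy {1}/y /zeta_inv -/m scalerDr !scalerA -addrA -scalerDl.
have -> : m * h * (h * m)^-1 = 1 by field; rewrite hn mn.
rewrite scale1r -[RHS]addr0; congr (_ + _); rewrite -[RHS](scale0r up).
by congr (_ *: _); field; rewrite hn mn.
Qed.

(** Identifying the image with a sector makes its openness a case of the openness of sectors. *)
Lemma zeta_image : zeta a b g s @` sector_set a b g s = sector_set a b 0 s.
Proof.
apply/seteqP; split=> [z [y Uy <-]|z Uz]; first exact: zeta_sector0.
by have [Uy zK] := zeta_invK Uz; exists (zeta_inv z).
Qed.

End InverseMap.
End TangentAlgebra.

(** * Smoothness *)

Section TangentSmoothness.
Context {R : realType} {N : nat} (a : 'M[R]_N) (b : 'rV[R]_N).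
Context (a_sym : a^T = a) (a_unit : a \in unitmx).
Context (b_norm : bilin (invmx a) b b = -1).
Implicit Types (u v w y z : 'rV[R]_N) (U : set 'rV[R]_N) (n : nat).
Local Notation b_ := (b_of b).
Local Notation up := (b_up a b).
Local Notation r := (bilin (r_form a b)).
Local Notation gam := (gam a b).
Local Notation q := (q_of a b).

Lemma Ck_on_b_of n U : open U -> Ck_on n U b_.
Proof.
move=> oU; apply: Ck_on_sum => // i; apply: Ck_onM => //.
  exact: Ck_on_cst.
exact: Ck_on_coord.
Qed.

Lemma Ck_on_bilin n U (A : 'M[R]_N) : open U -> Ck_on n U (fun y => bilin A y y).
Proof.
move=> oU; apply: Ck_on_sum => // i; apply: Ck_on_sum => // j.
apply: Ck_onM => //; last exact: Ck_on_coord.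
by apply: Ck_onM => //; [exact: Ck_on_cst|exact: Ck_on_coord].
Qed.

Lemma is_diff_b_of y : is_diff y b_ b_.
Proof.
apply: is_diff_eq.
  apply: is_diff_sum => i.
  exact: (is_diff_mul (is_diff_const _ _) (is_diff_coord _ _)).
by apply/funext => v; apply: eq_bigr => i _; rewrite mulr0 addr0.
Qed.

Lemma is_diff_bilin (A : 'M[R]_N) y :
  is_diff y (fun z => bilin A z z) (fun v => bilin A y v + bilin A v y).
Proof.
apply: is_diff_eq.
  apply: is_diff_sum => i; apply: is_diff_sum => j.
  exact: (is_diff_mul (is_diff_mul (is_diff_const _ _) (is_diff_coord _ _))
    (is_diff_coord _ _)).
apply/funext => v; rewrite -big_split; apply: eq_bigr => i _ /=.
by rewrite -big_split; apply: eq_bigr => j _ /=; ring.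
Qed.

Lemma is_diff_bilinl (A : 'M[R]_N) w y :
  is_diff y (fun z => bilin A z w) (fun v => bilin A v w).
Proof.
apply: is_diff_eq.
  apply: is_diff_sum => i; apply: is_diff_sum => j.
  exact: (is_diff_mul (is_diff_mul (is_diff_const _ _) (is_diff_coord _ _))
    (is_diff_const _ _)).
apply/funext => v; apply: eq_bigr => i _ /=.
by apply: eq_bigr => j _ /=; ring.
Qed.

Section FixedSector.
Context (g : R) (s : sector) (g_adm : admissible s g).
Local Notation e := (@sector_sign R s).
Local Notation h := (h_of g s).
Local Notation Bf := (B_of a b g).
Local Notation x_ := (J_arg a b g s).
Local Notation cone := (gam_cone a b s).

Lemma Ck_on_sign_gam n U : open U -> Ck_on n U (fun y => e * gam y).
Proof.
by move=> oU; apply: Ck_onM => //; [exact: Ck_on_cst|exact: Ck_on_bilin].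
Qed.

Lemma open_gam_cone : open cone.
Proof.
have := open_pos openT (@Ck_on_sign_gam 0 _ openT).
by congr open; apply/seteqP; split => [y []|y].
Qed.

Lemma Ck_on_q_of n U : open U -> U `<=` cone -> Ck_on n U q.
Proof.
move=> oU UC; apply: (Ck_on_ext oU) (Ck_on_sqrt oU _ (Ck_on_sign_gam n oU)).
  by move=> y /UC Cy; rewrite -q_of_cone.
by move=> y /UC.
Qed.

Lemma Ck_on_shifted_b n U : open U -> U `<=` cone ->
  Ck_on n U (fun y => b_ y + g / 2 * q y).
Proof.
move=> oU UC; apply: Ck_onD => //; first exact: Ck_on_b_of.
by apply: Ck_onM => //; [exact: Ck_on_cst|exact: Ck_on_q_of].
Qed.

Lemma Ck_on_J_arg n U : open U -> U `<=` cone -> Ck_on n U x_.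
Proof.
move=> oU UC; apply: Ck_onM => //; first exact: Ck_on_shifted_b.
apply: Ck_onV => // [y /UC Cy|].
  by rewrite mulf_neq0// gt_eqF ?(q_of_gt0 Cy)// h_of_gt0.
by apply: Ck_onM => //; [exact: Ck_on_cst|exact: Ck_on_q_of].
Qed.

(** Smoothness of [x_] is available on the cone, so the cone is shown open first and the sector is
    then cut out by positivity of [1 - e x ^ 2]. *)
Lemma open_sector_set : open (sector_set a b g s).
Proof.
have oC := open_gam_cone.
have cx : Ck_on 0 cone (fun y => 1 - e * x_ y ^+ 2).
  apply: Ck_onB => //; first exact: Ck_on_cst.
  apply: Ck_onM => //; first exact: Ck_on_cst.
  by apply: Ck_on_sqr => //; exact: Ck_on_J_arg.
have := open_pos oC cx; congr open.
by apply/seteqP; split => y /(sectorP a b g_adm).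
Qed.

Lemma sector_sub_cone : sector_set a b g s `<=` cone.
Proof. by move=> y /(sectorP a b g_adm)[]. Qed.

Local Notation U := (sector_set a b g s).
Let oU : open U := open_sector_set.
Let UC : U `<=` cone := sector_sub_cone.

Lemma Ck_on_J_of n : Ck_on n U (J_of a b g s).
Proof.
apply: (Ck_on_ext oU) (Ck_on_J_fun g oU _ (Ck_on_J_arg n oU UC)).
  by move=> y Uy; rewrite J_ofE.
by move=> y /(sectorP a b g_adm)[].
Qed.

Lemma Ck_on_B_of n : Ck_on n U Bf.
Proof.
apply: Ck_onB => //; last by apply: Ck_on_sqr => //; exact: Ck_on_b_of.
apply: Ck_onB => //; first exact: Ck_on_bilin.
apply: Ck_onM => //; last exact: Ck_on_q_of.
by apply: Ck_onM => //; [exact: Ck_on_cst|exact: Ck_on_b_of].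
Qed.

Lemma Ck_on_zeta_scale n : Ck_on n U (zeta_scale a b g s).
Proof.
apply: (Ck_on_ext oU) (Ck_onM oU (Ck_on_J_of n) (Ck_on_powR oU ((h - 1) / 2) _
    (Ck_onM oU (Ck_on_cst oU n e) (Ck_onM oU (Ck_on_B_of n)
      (Ck_on_sqr oU (Ck_on_J_of n)))))).
  by move=> y Uy; rewrite zeta_scaleE.
by move=> y Uy; exact: F2_gt0.
Qed.

Lemma smooth_on_zeta : smooth_on U (zeta a b g s).
Proof.
move=> n; have cl := Ck_on_zeta_scale n; have ch := Ck_on_cst oU n h.
apply: (Ck_on_ext oU) (Ck_onD oU (Ck_on_scale_id oU (Ck_onM oU cl ch))
  (Ck_onZl oU up (Ck_onM oU cl (Ck_onB oU (Ck_onM oU ch (Ck_on_b_of n oU))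
    (Ck_on_shifted_b n oU UC))))) => y _.
by rewrite zetaE.
Qed.

End FixedSector.

Section Inverse.
Context (g : R) (s : sector) (g_adm : admissible s g).
Local Notation e := (@sector_sign R s).
Local Notation h := (h_of g s).
Local Notation U0 := (sector_set a b 0 s).
Let oU : open U0 := open_sector_set (admissible0 s).
Let UC : U0 `<=` gam_cone a b s := sector_sub_cone (admissible0 s).

(** By surjectivity [z] is some [zeta y], where this quantity is a power of a positive number. *)
Lemma S2_gt0 z : U0 z -> 0 < e * S2 a z.
Proof.
move=> /(zeta_invK a_sym a_unit b_norm g_adm)[Uy <-].
by rewrite S2_zeta// powR_gt0// F2_gt0.
Qed.

Lemma zeta_inv_scale_gt0 z : U0 z -> 0 < zeta_inv_scale a b g s z.
Proof.
move=> Uz; rewrite mulr_gt0 ?powR_gt0 ?S2_gt0//; apply: J_fun_gt0.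
by case/sector0P : Uz.
Qed.

Lemma Ck_on_b_over_q n : Ck_on n U0 (fun z => b_ z / q z).
Proof.
apply: (Ck_on_ext oU) (Ck_on_J_arg (admissible0 s) n oU UC) => z _.
by rewrite J_arg0.
Qed.

Lemma Ck_on_zeta_inv_scale n : Ck_on n U0 (zeta_inv_scale a b g s).
Proof.
apply: Ck_onM => //.
  apply: Ck_on_J_fun => // [z|]; last exact: Ck_on_b_over_q.
  by case/sector0P.
apply: Ck_on_powR => //; first by move=> z; exact: S2_gt0.
by apply: Ck_onM => //; [exact: Ck_on_cst|exact: Ck_on_bilin].
Qed.

Lemma smooth_on_zeta_inv : smooth_on U0 (zeta_inv a b g s).
Proof.
move=> n; have cm := Ck_on_zeta_inv_scale n; have ch := Ck_on_cst oU n h.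
have cb := Ck_on_b_of n oU; have cq := Ck_on_q_of n oU UC.
have m0 z : U0 z -> zeta_inv_scale a b g s z != 0.
  by move=> Uz; rewrite gt_eqF// zeta_inv_scale_gt0.
have cmV := Ck_onV oU m0 cm.
have chm : Ck_on n U0 (fun z => (h * zeta_inv_scale a b g s z)^-1).
  apply: Ck_onV; last exact: Ck_onM.
    by [].
  by move=> z Uz; rewrite mulf_neq0 ?m0// gt_eqF// h_of_gt0.
apply: Ck_onD => //; first exact: Ck_on_scale_id.
apply: Ck_onZl => //; apply: Ck_onB => //; first exact: Ck_onM.
apply: Ck_onB => //; first exact: Ck_onM.
apply: Ck_onM => //; first exact: Ck_on_cst.
exact: Ck_onM.
Qed.

Lemma zeta_diffeo :
  diffeo_onto_image (sector_set a b g s) (zeta a b g s).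
Proof.
have im := zeta_image a_sym a_unit b_norm g_adm.
split; rewrite ?im//; first exact: open_sector_set.
  exact: smooth_on_zeta.
exists (zeta_inv a b g s); split; last exact: smooth_on_zeta_inv.
by move=> y Uy; exact: zetaK.
Qed.

End Inverse.
End TangentSmoothness.

(** * The two metrics *)

(** The isometry divided by [J ^ 2], with [r(y, u)], [r(y, w)], [r(u, w)], [b(u)], [b(w)] as
    independent scalars. [dJ] and [L] are the logarithmic derivatives of [J] and [lam]. *)
Lemma metric_identity (F : realFieldType) (e h g q b ru rw ruw bu bw : F) :
  e ^+ 2 = 1 -> h ^+ 2 = 1 + e * (g ^+ 2 / 4) -> h != 0 -> q != 0 ->
  e * q ^+ 2 - g * b * q - b ^+ 2 != 0 ->
  let B := e * q ^+ 2 - g * b * q - b ^+ 2 in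
  let dq r := e * r / q in
  let s := b + g / 2 * q in
  let ds r c := c + g / 2 * dq r in
  let K r c := r - (b + g * q) * c in
  let dJ r c := - (g / (2 * B)) * (q * c - b * dq r) in
  let L r c := dJ r c + (h - 1) * K r c / B in
  ruw - bu * bw - g * dq ru * bw + 2 * dJ ru bu * K rw bw =
  ruw + L rw bw * ru + L ru bu * rw + L ru bu * L rw bw * (e * q ^+ 2)
   - (h ^+ 2)^-1 * ((ds ru bu + L ru bu * s) * (ds rw bw + L rw bw * s)).
Proof.
move=> e2 h2 h0 q0; set B := (X in X != 0) => B0 /=.
have he : e * g ^+ 2 = 4 * (h ^+ 2 - 1) by rewrite h2; field.
(* Solved for a monomial, the relation can serve [field] as a reduction rule beside [e ^+ 2 = 1]. *)
have g2 : g ^+ 2 = 4 * e * (h ^+ 2 - 1).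
  by rewrite -mulrA mulrCA -he mulrA -expr2 e2 mul1r.
rewrite /B in B0 *.
field: e2 g2; by rewrite ?B0 ?q0 ?h0.
Qed.

(** * Differentials on the tangent space and comparison of the metrics *)

Section TangentDifferential.
Context {R : realType} {N : nat} (a : 'M[R]_N) (b : 'rV[R]_N).
Context (a_sym : a^T = a) (a_unit : a \in unitmx).
Context (b_norm : bilin (invmx a) b b = -1).
Context (g : R) (s : sector) (g_adm : admissible s g).
Implicit Types (u v w y z : 'rV[R]_N).
Local Notation b_ := (b_of b).
Local Notation up := (b_up a b).
Local Notation r := (bilin (r_form a b)).
Local Notation gam := (gam a b).
Local Notation q := (q_of a b).
Local Notation e := (@sector_sign R s).
Local Notation h := (h_of g s).
Local Notation Bf := (B_of a b g).
Local Notation x_ := (J_arg a b g s).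
Local Notation cone := (gam_cone a b s).
Local Notation U := (sector_set a b g s).
Local Notation J := (J_of a b g s).
Local Notation lam := (zeta_scale a b g s).

Definition dq y v : R := e * r y v / q y.
(** The logarithmic derivative of [J], with [h ^ 2 q ^ 2 (e - x ^ 2)] already gathered into [B]. *)
Definition dlnJ y v : R := - (g / (2 * Bf y)) * (q y * b_ v - b_ y * dq y v).
(* The derivative of [F2] divided by [2 * J ^ 2]. *)
Definition dF2 y v : R := r y v - (b_ y + g * q y) * b_ v.
Definition dlnlam y v : R := dlnJ y v + (h - 1) * dF2 y v / Bf y.

Let nbhsU y : U y -> \forall z \near y, U z.
Proof. by move=> Uy; apply: open_nbhs_nbhs; split=> //; exact: open_sector_set. Qed.

Let U_cone y : U y -> cone y.
Proof. exact: sector_sub_cone. Qed.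

Let q_neq0 y : U y -> q y != 0.
Proof. by move=> /U_cone Cy; rewrite gt_eqF// (q_of_gt0 Cy). Qed.

Let h_neq0 : h != 0.
Proof. by rewrite gt_eqF// h_of_gt0. Qed.

Let B_neq0 y : U y -> Bf y != 0.
Proof.
move=> Uy; apply/negP => /eqP By.
by have := sector_B_gt0 g_adm Uy; rewrite By mulr0 ltxx.
Qed.

Let J_gt0 y : U y -> 0 < J y.
Proof.
by move=> Uy; rewrite J_ofE//; apply: J_fun_gt0; case/(sectorP a b g_adm): Uy.
Qed.

Lemma is_diff_q_of y : U y -> is_diff y q (dq y).
Proof.
move=> Uy; have Cy := U_cone Uy.
have dg : is_diff y (fun z => e * gam z) (fun v => e * (2 * r y v)).
  apply: is_diff_eq (is_diff_mul (is_diff_const y e) (is_diff_bilin _ y)) _.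
  by apply/funext => v; rewrite mulr0 addr0 [r v y]r_formC//; ring.
apply: (is_diff_near (f := fun z => Num.sqrt (e * gam z))).
  by apply: filterS (nbhsU Uy) => z /U_cone Cz; rewrite -q_of_cone.
apply: is_diff_eq (is_diff_derivable dg (is_derive1_sqrt Cy)) _.
apply/funext => v; rewrite -q_of_cone// /dq; field.
exact: q_neq0.
Qed.

Lemma is_diff_shifted_b y c : U y ->
  is_diff y (fun z => b_ z + c * q z) (fun v => b_ v + c * dq y v).
Proof.
move=> Uy; apply: is_diff_eq.
  exact: (is_diff_add (is_diff_b_of b y)
    (is_diff_mul (is_diff_const y c) (is_diff_q_of Uy))).
by apply/funext => v; rewrite mulr0 addr0.
Qed.

(** Up to the constant [g / (2 h)] the function [x_] is [b / (h q)], so no term in [g] survives. *)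
Lemma is_diff_J_arg y : U y ->
  is_diff y x_ (fun v => (q y * b_ v - b_ y * dq y v) / (h * q y ^+ 2)).
Proof.
move=> Uy; have dhq := is_diff_mul (is_diff_const y h) (is_diff_q_of Uy).
apply: is_diff_eq.
  apply: (is_diff_mul (is_diff_shifted_b (g / 2) Uy) (is_diff_inv _ dhq)).
  by rewrite mulf_neq0// q_neq0.
by apply/funext => v; field; rewrite q_neq0// h_neq0.
Qed.

Lemma is_diff_J_of y : U y -> is_diff y J (fun v => J y * dlnJ y v).
Proof.
move=> Uy; have [Cy xy] := (sectorP a b g_adm y).1 Uy.
apply: (is_diff_near (f := fun z => J_fun g s (x_ z))).
  by apply: filterS (nbhsU Uy) => z Uz; rewrite J_ofE.
apply: is_diff_eq (is_diff_derivable (is_diff_J_arg Uy) (is_derive_J_fun g xy)) _.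
apply/funext => v; rewrite -J_ofE//.
have := B_neq0 Uy; rewrite /dlnJ (B_of_J_arg g_adm Cy) /G_of => B0.
have E0 : e - x_ y ^+ 2 != 0 by apply: contraNneq B0 => ->; rewrite mulr0.
by field; rewrite E0 q_neq0// h_neq0.
Qed.

Lemma is_diff_B_of y : U y ->
  is_diff y Bf (fun v => 2 * r y v - g * (b_ v * q y + b_ y * dq y v)
                         - 2 * b_ y * b_ v).
Proof.
move=> Uy; have db := is_diff_b_of b y; have dq := is_diff_q_of Uy.
apply: is_diff_eq.
  exact: (is_diff_add (is_diff_add (is_diff_bilin (r_form a b) y)
    (is_diff_opp (is_diff_mul (is_diff_mul (is_diff_const y g) db) dq)))
    (is_diff_opp (is_diff_mul db db))).
by apply/funext => v; rewrite [r v y]r_formC//; ring.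
Qed.

(** The terms [g * b * dq] coming from the differential of [B] and from [2 * B * dlnJ] cancel. *)
Lemma is_diff_F2 y : U y ->
  is_diff y (F2 a b g s) (fun v => 2 * J y ^+ 2 * dF2 y v).
Proof.
move=> Uy; have dJ := is_diff_J_of Uy.
apply: is_diff_eq.
  exact: (is_diff_mul (is_diff_B_of Uy) (is_diff_mul dJ dJ)).
apply/funext => v; have B0 := B_neq0 Uy; have q0 := q_neq0 Uy.
have e2 := @sector_sign_sqr R s.
rewrite /dlnJ /dF2.
have -> : 2 * r y v = 2 * q y * e * dq y v.
  by rewrite /dq; field: e2.
have -> : r y v = q y * e * dq y v by rewrite /dq; field: e2.
by field.
Qed.

Lemma is_diff_dF2 w y : U y ->
  is_diff y (fun z => dF2 z w) (fun v => r v w - (b_ v + g * dq y v) * b_ w).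
Proof.
move=> Uy; apply: is_diff_eq.
  exact: (is_diff_add (is_diff_bilinl (r_form a b) w y)
    (is_diff_opp (is_diff_mul (is_diff_shifted_b g Uy) (is_diff_const y (b_ w))))).
by apply/funext => v; ring.
Qed.

(** Leibniz rule applied to the first derivative [2 J ^ 2 dF2]. The formula is not visibly symmetric
    because the derivative is taken along [w] first and then along [u]. *)
Lemma finsler_metricE y u w : U y ->
  bilin (finsler_metric a b g s y) u w =
  J y ^+ 2 * (r u w - b_ u * b_ w - g * dq y u * b_ w + 2 * dlnJ y u * dF2 y w).
Proof.
move=> Uy.
pose H u w := J y ^+ 2 *
  (r u w - b_ u * b_ w - g * dq y u * b_ w + 2 * dlnJ y u * dF2 y w).
rewrite -[RHS]/(H u w) -(@bilin_delta _ _ H); last 2 first.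
- move=> {}w k {}u v; rewrite /H /dlnJ /dq.
  by rewrite !bilinDl !bilinDr !bilinZl !bilinZr !b_ofD !b_ofZ; ring.
- move=> {}u k {}w v; rewrite /H /dF2.
  by rewrite !bilinDr !bilinZr !b_ofD !b_ofZ; ring.
congr bilin; apply/matrixP => i j; rewrite !mxE.
set ei := delta_mx 0 i; set ej := delta_mx 0 j.
have -> : 'D_ei (fun z => 'D_ej (F2 a b g s) z) y =
    'D_ei (fun z => 2 * (J z * J z) * dF2 z ej) y.
  (* The inner derivative is known on [U], a neighbourhood of [y], which suffices for the outer
     one. *)
  apply: near_eq_derive; apply: filterS (nbhsU Uy) => z Uz.
  by have dF := is_diff_F2 Uz; rewrite (is_diff_derive _ dF) expr2.
have dJ := is_diff_J_of Uy.
have d := is_diff_mul (is_diff_mul (is_diff_const y (2 : R)) (is_diff_mul dJ dJ))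
  (is_diff_dF2 ej Uy).
by rewrite (is_diff_derive _ d) /H; field.
Qed.

(** The logarithmic derivative of [F2] is [2 dF2 / B], so the power [(h - 1) / 2] contributes
    [(h - 1) dF2 / B]. *)
Lemma is_diff_zeta_scale y : U y ->
  is_diff y lam (fun v => lam y * dlnlam y v).
Proof.
move=> Uy; have F0 := F2_gt0 g_adm Uy; have dJ := is_diff_J_of Uy.
apply: (is_diff_near
    (f := fun z => J z * (e * F2 a b g s z) `^ ((h - 1) / 2))).
  by apply: filterS (nbhsU Uy) => z Uz; rewrite zeta_scaleE.
have dF := is_diff_mul (is_diff_const y e) (is_diff_F2 Uy).
apply: is_diff_eq.
  exact: (is_diff_mul dJ (is_diff_derivable dF (is_derive1_powR ((h - 1) / 2) F0))).
apply/funext => v; rewrite zeta_scaleE// /dlnlam.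
rewrite powRB; last by rewrite (gt_eqF F0) implybT.
rewrite powRr1 ?ltW// {2 4}/F2.
have en : e != 0 by rewrite -sqrf_eq0 sector_sign_sqr oner_eq0.
by field; rewrite en B_neq0// gt_eqF// J_gt0.
Qed.

(** Factoring out [lam] keeps the shape [k *: u + l *: up] with [u = v + dlnlam y v *: y], ready for
    [r_form_comb] and [b_of_comb]. *)
Lemma is_diff_zeta y : U y ->
  is_diff y (zeta a b g s)
    (fun v => (lam y * h) *: (v + dlnlam y v *: y) +
      (lam y * (h * (b_ v + dlnlam y v * b_ y) -
        (b_ v + g / 2 * dq y v + dlnlam y v * (b_ y + g / 2 * q y)))) *: up).
Proof.
move=> Uy; have dl := is_diff_zeta_scale Uy.
have dh := is_diff_const y h; have db := is_diff_b_of b y.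
apply: (is_diff_near (f := fun y => (lam y * h) *: y +
    (lam y * (h * b_ y - (b_ y + g / 2 * q y))) *: up)).
  by apply: filterE => z; rewrite zetaE.
apply: is_diff_eq.
  exact: (is_diff_add (is_diff_scale_id (is_diff_mul dl dh))
    (is_diff_scalev up (is_diff_mul dl (is_diff_add (is_diff_mul dh db)
      (is_diff_opp (is_diff_shifted_b (g / 2) Uy)))))).
apply/funext => v; congr (_ + _ *: _); last by ring.
by rewrite scalerDr scalerA; congr (_ + _ *: _); ring.
Qed.

Lemma zeta_isometry y u w : U y ->
  bilin (finsler_metric a b g s y) u w =
  bilin (factor_metric a g s (zeta a b g s y))
    ('d (zeta a b g s) y u) ('d (zeta a b g s) y w).
Proof.
move=> Uy; have dz := is_diff_zeta Uy.
have q0 := q_neq0 Uy; have B0 := B_neq0 Uy; have h0 := h_neq0.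
have h2 := h_of_sqr g_adm; have e2 := @sector_sign_sqr R s.
have Cy := U_cone Uy.
rewrite finsler_metricE// diff_val bilin_scale p_of_zeta//.
rewrite [in RHS](bilin_r a b) r_form_comb// !b_of_comb//.
(* The conformal factor [varkappa ^ 2] cancels the one hidden in [lam], so both metrics carry the
   factor [J ^ 2]. *)
have kl : varkappa a b g s y ^+ 2 * lam y ^+ 2 = J y ^+ 2 / h ^+ 2.
  rewrite /zeta_scale; field; rewrite h0 /=.
  by rewrite -(mulIr_eq0 _ (mulIf h0)) varkappa_h// gt_eqF// powR_gt0// normr_gt0;
    apply: contraTneq (F2_gt0 g_adm Uy) => ->; rewrite mulr0 ltxx.
rewrite !bilinDl !bilinDr !bilinZl !bilinZr !b_ofD !b_ofZ.
rewrite [r u y]r_formC// -/(gam y) (gamE Cy).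
have By : Bf y = e * q y ^+ 2 - g * b_ y * q y - b_ y ^+ 2.
  by rewrite /B_of (gamE Cy).
have B0' := B0; rewrite By in B0'.
have id : r u w - b_ u * b_ w - g * dq y u * b_ w + 2 * dlnJ y u * dF2 y w =
    r u w + dlnlam y w * r y u + dlnlam y u * r y w +
    dlnlam y u * dlnlam y w * (e * q y ^+ 2) -
    (h ^+ 2)^-1 *
    ((b_ u + g / 2 * dq y u + dlnlam y u * (b_ y + g / 2 * q y)) *
     (b_ w + g / 2 * dq y w + dlnlam y w * (b_ y + g / 2 * q y))).
  rewrite /dlnlam /dlnJ By; exact: metric_identity.
rewrite id.
have -> : J y ^+ 2 = varkappa a b g s y ^+ 2 * lam y ^+ 2 * h ^+ 2.
  by rewrite kl divfK// expf_neq0.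
by field.
Qed.

End TangentDifferential.

(** The diagonal form has entries [1] and [-1], hence non-zero determinant; invertibility of the
    product passes to its middle factor. *)
Lemma lorentzian_unitmx (R : realType) (N : nat) (A : 'M[R]_N) :
  lorentzian A -> A \in unitmx.
Proof.
move=> [_ [P _ PA]].
have : P *m A *m P^T \in unitmx.
  rewrite PA unitmxE det_diag unitfE; apply/prodf_neq0 => i _.
  by rewrite mxE; case: ifP => _; rewrite ?oppr_eq0 oner_eq0.
by rewrite !unitmx_mul => /andP[/andP[]].
Qed.

Theorem mainTheorem2 (R : realType) (N : nat) (M : smooth_manifold R N)
    (a : pseudo_metric M) (b : one_form M) (g : scalar_field M)
    (b_norm : forall (i : chart_index M) (x : M), chart_dom (atlas i) x ->
       bilin (invmx (a i x)) (b i x) (b i x) = -1)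
    (i : chart_index M) (x : M) (dom_x : chart_dom (atlas i) x)
    (s : sector) (g_adm : admissible s (g x)) :
  let U := sector_set (a i x) (b i x) (g x) s in
  let Z := zeta (a i x) (b i x) (g x) s in
  diffeo_onto_image U Z /\
  forall y : 'rV[R]_N, U y ->
    forall u w : 'rV[R]_N,
      bilin (finsler_metric (a i x) (b i x) (g x) s y) u w =
      bilin (factor_metric (a i x) (g x) s (Z y)) ('d Z y u) ('d Z y w).
Proof.
(* At the fixed point [x] the signature supplies the symmetry and invertibility of [a i x] on which
   the tangent-space results rest. *)
move=> U Z; have lor := metric_lorentzian a dom_x.
have a_sym := lor.1; have a_unit := lorentzian_unitmx lor.
have bn := b_norm _ _ dom_x.
split; first exact: zeta_diffeo.
by move=> y Uy u w; exact: zeta_isometry.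
Qed.
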